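(* Let $n\ge 1$, $m\ge 2$ and $t\ge 3$ be integers and let $r=mt-1$. Then $$f(n,r,t+1)=\left(r-\left\lceil \frac{r}{t}\right\rceil\right)n.$$
   Context: For positive integers $n,r$ and $s\ge 2$, an $r$-partite graph with parts of size $n$ is a graph $G$ whose vertex set is partitioned into $r$ independent sets $V_1,\dots,V_r$, each of size $n$. $f(n,r,s)$ denotes the largest minimum degree $\delta(G)$ among all $r$-partite graphs $G$ with parts of size $n$ that contain no copy of the complete graph $K_{s}$. *)

(* Defs.v *)
From mathcomp Require Import all_boot all_order all_algebra.
From mathcomp Require Import zify.

Set Implicit Arguments.
Unset Strict Implicit.
Unset Printing Implicit Defensive.

Section Graphs.
Variables (T : finType) (e : rel T).

Definition simple_graph : bool :=
  [forall x, ~~ e x x] && [forall x, forall y, e x y == e y x].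

Definition degree (x : T) : nat := #|[set y | e x y]|.

(* Every degree is at most #|T|, so this default value does not affect the
   minimum when T is nonempty. *)
Definition min_degree : nat := \big[minn/#|T|]_(x : T) degree x.

Definition independent (A : {set T}) : bool :=
  [forall x in A, forall y in A, ~~ e x y].

Definition has_clique (s : nat) : bool :=
  [exists K : {set T}, (#|K| == s)
     && [forall x in K, forall y in K, (x != y) ==> e x y]].

(* The library's partition requires nonempty blocks, which is harmless for
   parts of size n > 0. *)
Definition multipartite (r n : nat) : bool :=
  [exists P : {set {set T}}, [&& partition P [set: T], #|P| == r &
     [forall A in P, (#|A| == n) && independent A]]].

Definition admissible (n r s : nat) : bool :=
  [&& simple_graph, multipartite r n & ~~ has_clique s].

End Graphs.

Definition edge_rel (T : finType) (E : {set T * T}) : rel T :=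
  fun x y => (x, y) \in E.

(* A graph with r parts of size n has r * n vertices, so up to isomorphism its
   vertex set is 'I_(r * n); f_attained and f_ub below confirm that f is the
   largest minimum degree over graphs on arbitrary finite types. *)
Definition f (n r s : nat) : nat :=
  \max_(E : {set 'I_(r * n) * 'I_(r * n)} | admissible (edge_rel E) n r s)
     min_degree (edge_rel E).

Lemma leq_min_degree (T : finType) (e : rel T) (k : nat) :
  (k <= min_degree e) = (k <= #|T|) && [forall x, k <= degree e x].
Proof.
rewrite /min_degree; apply/idP/andP => [|[kT /forallP kd]]; last first.
  by elim/big_ind: _ => // a b; rewrite leq_min => -> ->.
have gen (u : seq T) : k <= \big[minn/#|T|]_(x <- u) degree e x ->
    (k <= #|T|) && all (fun x => k <= degree e x) u.
  elim: u => [|x u IHu]; first by rewrite big_nil andbT.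
  by rewrite big_cons leq_min /= => /andP[-> /IHu].
move/gen/andP=> [-> /allP kd]; split=> //.
by apply/forallP=> x; apply: kd; rewrite mem_index_enum.
Qed.

Lemma multipartite_card (T : finType) (e : rel T) (r n : nat) :
  multipartite e r n -> #|T| = r * n.
Proof.
case/existsP=> P /and3P[pP /eqP <- /forallP cP].
rewrite -cardsT; apply: card_uniform_partition pP => A AP.
by have := cP A; rewrite AP => /andP[/eqP].
Qed.

Section Transport.
Variables (T U : finType) (h : T -> U) (g : U -> T).
Hypotheses (hK : cancel h g) (gK : cancel g h).
Variable e : rel T.
Let E : {set U * U} := [set p | e (g p.1) (g p.2)].

Let EE x y : edge_rel E x y = e (g x) (g y).
Proof. by rewrite /edge_rel inE. Qed.

Lemma transport_min_degree : min_degree (edge_rel E) = min_degree e.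
Proof.
have hb : bijective h by exists g.
have dE x : degree (edge_rel E) x = degree e (g x).
  rewrite /degree -(card_imset _ (can_inj hK)).
  apply: eq_card => y; rewrite inE EE.
  by rewrite -[in RHS](gK y) (mem_imset _ _ (can_inj hK)) inE.
have le k : (k <= min_degree (edge_rel E)) = (k <= min_degree e).
  rewrite !leq_min_degree (bij_eq_card hb); congr (_ && _).
  apply/forallP/forallP=> H x; last by rewrite dE.
  by rewrite -(hK x) -dE.
by apply/eqP; rewrite eqn_leq -le leqnn le leqnn.
Qed.

Lemma transport_admissible n r s :
  admissible e n r s -> admissible (edge_rel E) n r s.
Proof.
case/and3P=> /andP[/forallP eI /forallP eS] eM eC; apply/and3P; split.
- apply/andP; split; apply/forallP=> x; first by rewrite EE.
  by apply/forallP=> y; rewrite !EE; move/forallP: (eS (g x)).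
- case/existsP: eM => P /and3P[pP cP /forall_inP bP].
  have hi := can_inj hK.
  apply/existsP; exists [set h @: A | A : {set T} in P]; apply/and3P; split.
  + have -> : [set: U] = h @: [set: T].
      by apply/setP=> y; rewrite -[y]gK (mem_imset _ _ hi) !inE.
    by rewrite imset_partition // => x y _ _ /hi.
  + by rewrite card_imset //; apply: imset_inj.
  + apply/forall_inP=> _ /imsetP[A AP ->]; rewrite card_imset //.
    have /andP[-> /forall_inP iA] := bP A AP.
    apply/forall_inP=> _ /imsetP[x xA ->].
    apply/forall_inP=> _ /imsetP[y yA ->]; rewrite EE !hK.
    by have /forall_inP := iA x xA; apply.
- apply: contra eC => /existsP[K /andP[cK /forall_inP aK]].
  apply/existsP; exists (g @: K); have gi := can_inj gK.
  rewrite card_imset // cK /=.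
  apply/forall_inP=> _ /imsetP[x xK ->].
  apply/forall_inP=> _ /imsetP[y yK ->]; rewrite (inj_eq gi) -EE.
  by have /forall_inP := aK x xK; apply.
Qed.

End Transport.

Lemma f_ub (T : finType) (e : rel T) (n r s : nat) :
  admissible e n r s -> min_degree e <= f n r s.
Proof.
move=> ae; have /and3P[_ /multipartite_card cT _] := ae.
have ck : cancel (cast_ord cT \o enum_rank) (enum_val \o cast_ord (esym cT)).
  by move=> x /=; rewrite cast_ordK enum_rankK.
have ck' : cancel (enum_val \o cast_ord (esym cT)) (cast_ord cT \o @enum_rank T).
  by move=> x /=; rewrite enum_valK cast_ordKV.
rewrite -(transport_min_degree ck ck' e).
have := transport_admissible ck ck' ae; move: [set _ | _] => E aE.
exact: (@bigop.leq_bigmax_cond _ (fun E => admissible (edge_rel E) n r s)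
  (fun E => min_degree (edge_rel E))).
Qed.

Lemma f_attained (n r s : nat) : 0 < n -> 1 < s ->
  exists E : {set 'I_(r * n) * 'I_(r * n)},
    admissible (edge_rel E) n r s /\ min_degree (edge_rel E) = f n r s.
Proof.
move=> n0 s1; pose T := 'I_(r * n).
have a0 : admissible (edge_rel (set0 : {set T * T})) n r s.
  apply/and3P; split.
  - apply/andP; split; apply/forallP=> x; first by rewrite /edge_rel inE.
    by apply/forallP=> y; rewrite /edge_rel !inE.
  - pose B (i : 'I_r) := [set x : T | x %/ n == i].
    have lt (i : 'I_r) (j : 'I_n) : i * n + j < r * n.
      by have := ltn_ord i; have := ltn_ord j; nia.
    have cB i : #|B i| = n.
      rewrite -[RHS]card_ord -(@card_imset _ _ (fun j => Ordinal (lt i j))).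
        apply: eq_card => x; rewrite inE; apply/eqP/imsetP => [xi|[j _ ->]].
          exists (Ordinal (ltn_pmod x n0)) => //; apply: val_inj => /=.
          by rewrite -xi -divn_eq.
        by rewrite /= divnMDl // divn_small ?addn0.
      by move=> j k /(congr1 val) /= /addnI /val_inj.
    have Bi : injective B.
      move=> i j Bij; have /card_gt0P[x xi] : 0 < #|B i| by rewrite cB.
      have := xi; rewrite {1}Bij !inE => /eqP xj.
      by apply: val_inj; move: xi xj; rewrite inE => /eqP -> .
    apply/existsP; exists [set B i | i : 'I_r]; apply/and3P; split.
    + apply/and3P; split.
      * apply/eqP/setP=> x; rewrite inE.
        have lx : x %/ n < r by rewrite ltn_divLR.
        by apply/bigcupP; exists (B (Ordinal lx)); rewrite ?imset_f // inE.
      * apply/trivIsetP=> _ _ /imsetP[i _ ->] /imsetP[j _ ->] nij.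
        rewrite -setI_eq0; apply/set0Pn => -[x]; rewrite !inE => /andP[/eqP xi /eqP xj].
        by case/eqP: nij; congr B; apply: val_inj; rewrite /= -xi -xj.
      * apply/imsetP=> -[i _ /esym B0]; have := cB i.
        by rewrite B0 cards0 => n0'; rewrite -n0' in n0.
    + by rewrite card_imset // card_ord.
    + apply/forall_inP=> _ /imsetP[i _ ->]; rewrite cB eqxx /=.
      by apply/forall_inP=> x _; apply/forall_inP=> y _; rewrite /edge_rel inE.
  - apply/existsP=> -[K /andP[/eqP cK /forall_inP aK]].
    have /card_gt1P[x [y [xK yK xy]]] : 1 < #|K| by rewrite cK.
    by have /forall_inP/(_ y yK) := aK x xK; rewrite xy /edge_rel inE.
have [E aE fE] := @eq_bigmax_cond {set T * T}
  [pred E : {set T * T} | admissible (edge_rel E) n r s]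
  (fun E => min_degree (edge_rel E)) (introT card_gt0P (ex_intro _ set0 a0)).
by exists E; split.
Qed.

(* Main.v *)
(** Lower bound: group the [mt - 1] parts into [t] groups of at most [m] parts
    and join two vertices whenever their groups differ.

    Upper bound: suppose every vertex has fewer than [mn] non-neighbours
    (itself included) and there is no [K_(t+1)].  Each vertex misses some
    vertex of every [t]-clique [K], so fewer than [n] vertices miss two or more
    vertices of [K].  Among all [(t-1)]-cliques [Q] and sets [J] of [m - 1]
    parts choose a pair maximising the size of [X], the set of common
    neighbours of [Q] lying in [J].  As [Q] has more than [(m-1)n] common
    neighbours, one of them, [w], lies outside [J], in a part [L], and it misses
    [X] by [K_(t+1)]-freeness.  As [w] misses [L] and fewer than [mn] vertices,
    it has a neighbour [z] in some part [A] of [J].  Extend [{w, z}] greedily to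
    a [t]-clique [K].  Then [X :&: A] misses both [w] and [z], while the
    vertices of [L :|: (X :\: A)] missing only [w] in [K] are common neighbours
    of [K :\ w] in [J] with [A] exchanged for [L], so there are at most [#|X|] of
    them.  Hence at least [n] vertices miss two vertices of [K], a
    contradiction. *)
Require Import Defs.
From mathcomp Require Import all_boot all_order all_algebra.
From mathcomp Require Import zify lra.

Set Implicit Arguments.
Unset Strict Implicit.

Lemma subset_of_card (T : finType) (P : {set T}) (k : nat) :
  k <= #|P| -> exists2 J : {set T}, J \subset P & #|J| = k.
Proof.
rewrite -bin_gt0 -cards_draws => /card_gt0P[J].
by rewrite inE => /andP[sJ /eqP cJ]; exists J.
Qed.

Lemma card_cover_uniform (T : finType) (P J : {set {set T}}) (n : nat) :
  trivIset P -> {in P, forall A : {set T}, #|A| = n} -> J \subset P ->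
  #|cover J| = #|J| * n.
Proof.
move=> tP cP sJ; have /eqP <- := trivIsetS sJ tP.
by rewrite -sum_nat_const; apply: eq_bigr => A AJ; rewrite cP ?(subsetP sJ).
Qed.

(** * Cliques, common neighbours and counting non-adjacent pairs *)

Section Cliques.
Variables (T : finType) (e : rel T).
Implicit Types (x y w : T) (K L Q : {set T}).
Hypotheses (eI : irreflexive e) (eS : symmetric e).

Definition non_nbrs (x : T) : {set T} := [set y | ~~ e x y].

Definition is_clique (K : {set T}) : bool :=
  [forall x in K, forall y in K, (x != y) ==> e x y].

Definition common_nbrs (Q : {set T}) : {set T} := [set y | [forall x in Q, e x y]].

Lemma degree_non_nbrs x : degree e x + #|non_nbrs x| = #|T|.
Proof.
rewrite -[RHS](cardsC [set y | e x y]); congr (_ + _).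
by apply: eq_card => y; rewrite !inE.
Qed.

Lemma is_cliqueP K :
  reflect {in K &, forall x y, x != y -> e x y} (is_clique K).
Proof.
apply: (iffP forall_inP) => [cK x y xK yK | cK x xK].
  by move/forall_inP: (cK x xK) => /(_ y yK) /implyP.
by apply/forall_inP=> y yK; apply/implyP; apply: cK.
Qed.

Lemma is_cliqueS K L : K \subset L -> is_clique L -> is_clique K.
Proof.
move=> /subsetP sKL /is_cliqueP cL; apply/is_cliqueP=> x y xK yK.
by apply: cL; apply: sKL.
Qed.

Lemma is_cliqueU1 Q y : is_clique Q -> y \in common_nbrs Q -> is_clique (y |: Q).
Proof.
move=> /is_cliqueP cQ; rewrite inE => /forall_inP yQ.
apply/is_cliqueP=> a b /setU1P[->|aQ] /setU1P[->|bQ] ab.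
- by rewrite eqxx in ab.
- by rewrite eS yQ.
- exact: yQ.
- exact: cQ.
Qed.

Lemma common_nbrs_notin Q y : y \in common_nbrs Q -> y \notin Q.
Proof.
by rewrite inE => /forall_inP yQ; apply/negP=> /yQ; rewrite eI.
Qed.

Lemma has_clique_common_nbrs Q y :
  is_clique Q -> y \in common_nbrs Q -> has_clique e #|Q|.+1.
Proof.
move=> cQ yQ; apply/existsP; exists (y |: Q).
rewrite cardsU1 (common_nbrs_notin yQ) /= add1n eqxx /=; exact: is_cliqueU1.
Qed.

Lemma card_common_nbrs Q d : (forall x, #|non_nbrs x| <= d) ->
  #|T| <= #|common_nbrs Q| + #|Q| * d.
Proof.
move=> hd; rewrite -(cardsC (common_nbrs Q)) leq_add2l.
rewrite -sum_nat_const.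
have -> : ~: common_nbrs Q = \bigcup_(x in Q) non_nbrs x.
  apply/setP=> y; rewrite !inE; apply/forall_inPn/bigcupP => -[x xQ].
    by move=> nxy; exists x; rewrite ?inE.
  by rewrite inE => nxy; exists x.
elim/big_ind2: _ => [|a A b B lA lB|x _]; rewrite ?cards0 //.
by rewrite (leq_trans (leq_of_leqif (leq_card_setU A B))) ?leq_add.
Qed.

(** While [#|Q| < t], the non-neighbours of the members of [Q] number at most [t.-1 * d < #|T|], so
    a common neighbour is left to add. *)
Lemma clique_extend t d Q : (forall x, #|non_nbrs x| <= d) ->
  t.-1 * d < #|T| -> is_clique Q -> #|Q| <= t ->
  exists K, [/\ Q \subset K, is_clique K & #|K| = t].
Proof.
move=> hd lt; move: {2}(t - #|Q|) (erefl (t - #|Q|)) => k.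
elim: k Q => [|k IHk] Q tQ cQ leQ; first by exists Q; split=> //; lia.
have /card_gt0P[y yQ] : 0 < #|common_nbrs Q|.
  have := @card_common_nbrs Q d hd.
  have : #|Q| * d <= t.-1 * d by rewrite leq_mul2r; lia.
  lia.
have cyQ : #|y |: Q| = #|Q|.+1 by rewrite cardsU1 (common_nbrs_notin yQ).
have [||K [sK cK tK]] := IHk (y |: Q) _ (is_cliqueU1 cQ yQ); rewrite ?cyQ; try lia.
by exists K; split=> //; apply: subset_trans sK; apply: subsetUr.
Qed.

(** For irreflexive [e] a member of a clique [K] misses only itself in [K], hence is never counted
    here. *)
Definition twice_missed (K : {set T}) : {set T} :=
  [set y | 1 < #|[set x in K | ~~ e x y]|].

Lemma twice_missedP K x x' y : x \in K -> x' \in K -> x != x' ->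
  ~~ e x y -> ~~ e x' y -> y \in twice_missed K.
Proof.
move=> xK x'K xx' nx nx'; rewrite inE; apply/card_gt1P.
by exists x, x'; rewrite !inE xK x'K.
Qed.

Lemma once_missed_common_nbrs K w y : w \in K -> ~~ e w y ->
  y \notin twice_missed K -> y \in common_nbrs (K :\ w).
Proof.
move=> wK nwy; rewrite [y \in common_nbrs _]inE => yB.
apply/forall_inP=> x /setD1P[xw xK]; apply: contraR yB => nxy.
exact: twice_missedP xK wK xw nxy nwy.
Qed.

(** Double counting of pairs [(x, y)] with [x] in [K] and [~~ e x y]: each [x] lies in at most [d]
    pairs, each [y] in at least one (otherwise [y] extends [K]), and in at least two if [y] is twice
    missed. *)
Lemma card_twice_missed K d : (forall x, #|non_nbrs x| <= d) ->
  is_clique K -> ~~ has_clique e #|K|.+1 ->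
  #|T| + #|twice_missed K| <= #|K| * d.
Proof.
move=> hd cK nK.
have -> : #|T| + #|twice_missed K| = \sum_(y : T) (1 + (y \in twice_missed K)).
  rewrite big_split /= sum1_card; congr (_ + _).
  by rewrite -sum1_card big_mkcond; apply: eq_bigr => y _; case: (_ \in _).
apply: (@leq_trans (\sum_(y : T) #|[set x in K | ~~ e x y]|)).
  apply: leq_sum => y _; rewrite [y \in _]inE.
  have [|] := ltnP 1 #|[set x in K | ~~ e x y]| => [//|_].
  rewrite addn0 card_gt0; apply: contra nK => /eqP K0.
  apply: (has_clique_common_nbrs (y := y)) => //; rewrite inE.
  apply/forall_inP=> x xK; have /setP/(_ x) := K0.
  by rewrite !inE xK /= => /negbFE.
under eq_bigr => y _ do rewrite -sum1_card.
rewrite (exchange_big_dep (mem K)) /= => [|y x _]; last by rewrite inE => /andP[].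
rewrite -sum_nat_const; apply: leq_sum => x xK.
rewrite sum1dep_card; apply: leq_trans (hd x).
by apply/subset_leq_card/subsetP=> y; rewrite !inE xK.
Qed.

End Cliques.

(** * Upper bound: the extremal argument *)

Lemma clique_of_large_degree (T : finType) (e : rel T) (n m t : nat) :
  0 < n -> 0 < m -> 1 < t -> simple_graph e -> multipartite e (m * t - 1) n ->
  (forall x, #|non_nbrs e x| < m * n) -> has_clique e t.+1.
Proof.
move=> n0 m0 t1 /andP[/forallP eI' /forallP eS'] mP hd'.
have eI : irreflexive e by move=> x; apply/negbTE.
have eS : symmetric e by move=> x y; have /forallP/(_ y)/eqP := eS' x.
have cT := multipartite_card mP.
case/existsP: mP => P /and3P[/and3P[/eqP covP tP _] /eqP rP /forall_inP bP].
have cP : {in P, forall A : {set T}, #|A| = n} by move=> A /bP/andP[/eqP].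
have iP A x y : A \in P -> x \in A -> y \in A -> ~~ e x y.
  by move=> /bP/andP[_ /forall_inP iA] /iA/forall_inP; apply.
have hd x : #|non_nbrs e x| <= (m * n).-1 by have := hd' x; lia.
have tT : t.-1 * (m * n).-1 < #|T| by rewrite cT; nia.
apply: contraT => nK.
have c0 : is_clique e set0 by apply/is_cliqueP=> x y; rewrite inE.
have [Q0 [_ cQ0 sQ0]] : exists Q : {set T},
    [/\ set0 \subset Q, is_clique e Q & #|Q| = t.-1].
  apply: (@clique_extend _ _ eI eS t.-1 (m * n).-1 set0 hd) => //.
    by apply: leq_ltn_trans tT; rewrite leq_mul2r; lia.
  by rewrite cards0.
have [J0 sJ0 cJ0] : exists2 J : {set {set T}}, J \subset P & #|J| = m.-1.
  by apply: subset_of_card; rewrite rP; nia.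
pose valid (p : {set T} * {set {set T}}) :=
  [&& is_clique e p.1, #|p.1| == t.-1, p.2 \subset P & #|p.2| == m.-1].
pose size_in (p : {set T} * {set {set T}}) := #|common_nbrs e p.1 :&: cover p.2|.
have v0 : valid (Q0, J0) by rewrite /valid /= cQ0 sQ0 sJ0 cJ0 !eqxx.
case: (arg_maxnP size_in v0) => -[Q J] /and4P[/= cQ /eqP sQ sJ /eqP cJ] maxQJ.
set X := common_nbrs e Q :&: cover J.
have cardJ : #|cover J| = m.-1 * n by rewrite (card_cover_uniform tP cP sJ) cJ.
(* [Q] has at least [(m * t - 1) * n - (t - 1) * (m * n - 1) = (m - 1) * n + (t - 1)] common
   neighbours, too many for [cover J]. *)
have /subsetPn[w wQ wJ] : ~~ (common_nbrs e Q \subset cover J).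
  apply/negP=> /subset_leq_card; rewrite cardJ.
  have := @card_common_nbrs _ e Q _ hd; rewrite cT sQ.
  nia.
have wP : w \in cover P by rewrite covP inE.
set L := pblock P w.
have LP : L \in P by apply: pblock_mem.
have wL : w \in L by rewrite mem_pblock.
have LJ : L \notin J by apply: contra wJ => LJ; apply/bigcupP; exists L.
have disj A B : A \in P -> B \in P -> A != B -> [disjoint A & B].
  by move=> AP BP; apply: (trivIsetP tP).
have LJd : [disjoint L & cover J].
  rewrite -setI_eq0; apply/set0Pn=> -[x /setIP[xL /bigcupP[B BJ xB]]].
  have BP := subsetP sJ _ BJ.
  case: (eqVneq L B) => [LB|/(disj _ _ LP BP)/pred0P/(_ x)].
    by rewrite LB BJ in LJ.
  by rewrite /= xL xB.
have wX x : x \in X -> ~~ e w x.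
  move=> /setIP[xQ _]; apply: contra nK => wx.
  have cwQ : is_clique e (w |: Q) by apply: is_cliqueU1.
  have <- : #|w |: Q| = t by rewrite cardsU1 (common_nbrs_notin eI wQ) sQ add1n prednK // ltnW.
  apply: (has_clique_common_nbrs eI eS (y := x)) => //.
  rewrite inE; apply/forall_inP=> v /setU1P[->//|vQ].
  by move: xQ; rewrite inE => /forall_inP; apply.
(* Otherwise [w] would miss all [m * n] vertices of [L] and [cover J]. *)
have /subsetPn[z /bigcupP[A AJ zA] nwz] : ~~ (cover J \subset non_nbrs e w).
  apply/negP=> sub.
  have : L :|: cover J \subset non_nbrs e w.
    by rewrite subUset sub andbT; apply/subsetP=> x xL; rewrite inE (iP L).
  move=> /subset_leq_card; rewrite cardsU disjoint_setI0 // cards0 subn0.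
  by rewrite cardJ cP // -mulSn prednK // leqNgt hd'.
have AP := subsetP sJ _ AJ.
have AL : A != L by apply: contraNneq LJ => <-.
move: nwz; rewrite inE negbK => ewz.
have wz : w != z by apply: contraTneq ewz => ->; rewrite eI.
have [||K [sK cK tK]] := @clique_extend _ _ eI eS t _ [set w; z] hd tT.
- apply/is_cliqueP=> a b /set2P[]-> /set2P[]->; rewrite ?eqxx //.
  by rewrite eS ewz.
- by rewrite cards2 wz.
have wK : w \in K by apply: (subsetP sK); rewrite !inE eqxx.
have zK : z \in K by apply: (subsetP sK); rewrite !inE eqxx orbT.
set B := twice_missed e K.
(* In fact [#|B| <= t * (m * n - 1) - (m * t - 1) * n = n - t]. *)
have cB : #|B| < n.
  have := @card_twice_missed _ _ eI eS K _ hd cK; rewrite tK nK => /(_ isT).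
  rewrite cT -/B; move: #|B| => b; clear -n0 m0 t1; nia.
(* [w] misses all of [S], so a vertex of [S] outside [B] is adjacent to all of [K :\ w]. *)
set S := L :|: (X :\: A).
have LX : [disjoint L & X] := disjointWr (subsetIr _ _) LJd.
have cS : #|S| = n + #|X :\: A|.
  rewrite cardsU (disjoint_setI0 (disjointWr (subsetDl X A) LX)).
  by rewrite cards0 subn0 cP.
have SB : #|S :\: B| <= #|X|.
  (* The exchanged pair competes with [(Q, J)], so maximality bounds [#|S :\: B|]. *)
  have vJ : valid (K :\ w, L |: (J :\ A)).
    rewrite /valid /= (is_cliqueS (subD1set K w) cK).
    have := cardsD1 w K; rewrite tK wK add1n => -> /=.
    rewrite cardsU1 !inE (negbTE LJ) andbF /=.
    have := cardsD1 A J; rewrite cJ AJ => <-.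
    by rewrite subUset sub1set LP (subset_trans (subD1set J A) sJ) !eqxx.
  apply: leq_trans (maxQJ _ vJ); apply/subset_leq_card/subsetP=> x.
  rewrite !inE /= => /andP[xB /orP[xL|/andP[xA xX]]].
    apply/andP; split; last by apply/bigcupP; exists L; rewrite ?setU11.
    have := @once_missed_common_nbrs _ e K w x wK (iP L _ _ LP wL xL).
    by rewrite !inE; apply.
  have /setIP[_ /bigcupP[C CJ xC]] : x \in X by rewrite !inE.
  apply/andP; split.
    have := @once_missed_common_nbrs _ e K w x wK; rewrite !inE; apply=> //.
    by apply: wX; rewrite !inE.
  apply/bigcupP; exists C => //; rewrite !inE CJ andbT.
  by rewrite (contraNneq _ xA) ?orbT // => <-.
have XAB : X :&: A \subset B.
  apply/subsetP=> x /setIP[xX xA]; apply: twice_missedP wK zK wz _ _.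
    exact: wX.
  exact: iP AP zA xA.
(* With [SB] and [cS] this gives [#|B| >= #|X :&: A| + (n + #|X :\: A|) - #|X| = n], against
   [cB]. *)
have : #|(X :&: A) :|: (S :&: B)| <= #|B|.
  by apply: subset_leq_card; rewrite subUset XAB subsetIr.
have SA : [disjoint X :&: A & S :&: B].
  rewrite -setI_eq0; apply/set0Pn=> -[x /setIP[/setIP[_ xA] /setIP[]]].
  rewrite !inE xA /= orbF => xL _.
  by have /pred0P/(_ x) := disj _ _ AP LP AL; rewrite /= xA xL.
rewrite cardsU (disjoint_setI0 SA) cards0 subn0.
have := cardsID B S; have := cardsID A X; clear -cS SB cB; lia.
Qed.

(** * Lower bound: the grouped construction *)

Section LowerBound.
Variables (n m r : nat).

Definition grouped_edge : rel ('I_r * 'I_n) := fun x y => x.1 %/ m != y.1 %/ m.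

Lemma grouped_edge_admissible (t : nat) : 0 < n -> 0 < m -> r <= m * t ->
  admissible grouped_edge n r t.+1.
Proof.
move=> n0 m0 rmt.
pose V (i : 'I_r) := [set x : 'I_r * 'I_n | x.1 == i].
have cV i : #|V i| = n.
  have -> : V i = setX [set i] setT by apply/setP=> x; rewrite !inE andbT.
  by rewrite cardsX cards1 cardsT card_ord mul1n.
have Vi : injective V.
  move=> i j /setP/(_ (i, Ordinal n0)); rewrite !inE eqxx.
  by move/esym/eqP.
apply/and3P; split.
- apply/andP; split; apply/forallP=> x; first by rewrite /grouped_edge eqxx.
  by apply/forallP=> y; apply/eqP; congr negb; apply: eq_sym.
- apply/existsP; exists [set V i | i : 'I_r]; apply/and3P; split.
  + apply/and3P; split.
    * apply/eqP/setP=> x; rewrite inE; apply/bigcupP.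
      by exists (V x.1); rewrite ?imset_f // inE.
    * apply/trivIsetP=> _ _ /imsetP[i _ ->] /imsetP[j _ ->] nij.
      rewrite -setI_eq0; apply/set0Pn => -[x]; rewrite !inE => /andP[/eqP xi /eqP xj].
      by case/eqP: nij; rewrite -xi -xj.
    * apply/imsetP=> -[i _ /esym V0]; have := cV i.
      by rewrite V0 cards0; lia.
  + by rewrite card_imset // card_ord.
  + apply/forall_inP=> _ /imsetP[i _ ->]; rewrite cV eqxx /=.
    apply/forall_inP=> x; rewrite inE => /eqP xi.
    apply/forall_inP=> y; rewrite inE => /eqP yi.
    by rewrite /grouped_edge xi yi eqxx.
- apply/existsP=> -[K /andP[/eqP cK /forall_inP aK]].
  (* The vertices of a clique lie in distinct groups, and there are at most [t] groups. *)
  have lt (x : 'I_r * 'I_n) : x.1 %/ m < t.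
    by rewrite ltn_divLR // mulnC (leq_trans (ltn_ord _)).
  have inj : {in K &, injective (fun x => Ordinal (lt x))}.
    move=> x y xK yK /(congr1 val) /= xy; apply/eqP; apply: contraT => nxy.
    by have /forall_inP/(_ y yK) := aK x xK; rewrite nxy /grouped_edge xy eqxx.
  by have := max_card (mem [set Ordinal (lt x) | x in K]);
    rewrite card_in_imset // cK card_ord ltnn.
Qed.

Lemma grouped_edge_min_degree : 0 < m -> (r - m) * n <= min_degree grouped_edge.
Proof.
move=> m0.
rewrite leq_min_degree card_prod !card_ord leq_mul2r leq_subr orbT /=.
apply/forallP=> x; have := degree_non_nbrs grouped_edge x.
rewrite card_prod !card_ord; suff : #|non_nbrs grouped_edge x| <= m * n by nia.
(* Non-neighbours of [x] share its group, so the remainder of the part index and the position in the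
   part determine them. *)
have mod_lt (y : 'I_r * 'I_n) : y.1 %% m < m by rewrite ltn_mod.
pose h (y : 'I_r * 'I_n) := (Ordinal (mod_lt y), y.2).
rewrite -(@card_in_imset _ _ h) => [|y y'].
  by apply: leq_trans (max_card _) _; rewrite card_prod !card_ord.
rewrite !inE !negbK => /eqP hy /eqP hy' [] hm h2.
rewrite [y]surjective_pairing [y']surjective_pairing h2; congr pair.
by apply: val_inj; rewrite /= (divn_eq y.1 m) (divn_eq y'.1 m) -hy -hy' hm.
Qed.

End LowerBound.

(** The quotient is [m - 1/t], which lies strictly above [m - 1] because [t > 1]. *)
Lemma ceil_pred_mul_div (m t : nat) : 0 < m -> 1 < t ->
  Num.ceil ((m * t - 1)%:R / t%:R : rat)%R = Posz m.
Proof.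
move=> m0 t1; apply: Num.Theory.ceil_def.
have t0 : (1 < t%:R :> rat)%R by rewrite Num.Theory.ltr1n.
rewrite GRing.natrB ?muln_gt0 ?m0 1?ltnW // GRing.natrM GRing.rmorphB /=.
have -> : ((Posz m)%:~R = m%:R :> rat)%R by [].
rewrite Num.Theory.ltr_pdivlMr ?Num.Theory.ler_pdivrMr; lra.
Qed.

Unset Implicit Arguments.

Theorem theorem1p2 (n m t r : nat) (hn : (1 <= n)%N) (hm : (2 <= m)%N)
    (ht : (3 <= t)%N) (hr : r = (m * t - 1)%N) :
  (Posz (f n r t.+1) =
     (Posz r - Num.ceil (r%:R / t%:R : rat)) * Posz n)%R.
Proof.
have m0 : 0 < m by lia.
have t1 : 1 < t by lia.
suff fE : f n r t.+1 = (r - m) * n.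
  rewrite fE hr ceil_pred_mul_div //.
  have le_m : m <= m * t - 1 by nia.
  by rewrite subzn // PoszM.
apply/eqP; rewrite eqn_leq; apply/andP; split; last first.
  have rmt : r <= m * t by lia.
  apply: leq_trans (@grouped_edge_min_degree n m r m0) _.
  exact: f_ub (grouped_edge_admissible hn m0 rmt).
have [E [/and3P[gE mE nE] <-]] := @f_attained n r t.+1 hn (ltnW (ltnW ht)).
(* A minimum degree above [(r - m) * n] leaves every vertex fewer than [m * n] non-neighbours, since
   [m <= r]. *)
rewrite leqNgt; apply: contra nE; rewrite leq_min_degree => /andP[_ /forallP dE].
rewrite hr in E gE mE dE *.
apply: (clique_of_large_degree hn m0 t1) => // x.
have := degree_non_nbrs (edge_rel E) x; have := dE x; rewrite card_ord.
have : m <= m * t - 1 by nia.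
nia.
Qed.
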